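(* Let $f:\mathbb{R}^n\to\mathbb{R}^m$ ($m\ge 2$) with prediction function $F(x)=\operatorname{argmax}_{i\in[m]} f_i(x)$, let $\|\cdot\|$ be a norm on $\mathbb{R}^n$, let $\epsilon>0$, and for each $i\in[m]$ let $K_i$ be an upper bound on the (global) Lipschitz constant of $f_i$ with respect to $\|\cdot\|$. Let $\bar F^{\epsilon/2}:\mathbb{R}^n\to[m]\cup\{\bot\}$ be the prediction function of the GloRo Net $\bar f^{\epsilon/2}$ built from $f$, radius $\epsilon/2$ and $(K_i)_{i\in[m]}$. Then $\bar F^{\epsilon/2}$ is $\epsilon$-globally-robust with respect to $\|\cdot\|$.
   Context: $[m]=\{1,\dots,m\}$; $f_i$ is the $i$-th coordinate of $f$. In $F(x)=\operatorname{argmax}_i f_i(x)$, ties are broken by some arbitrary fixed rule, so $F(x)$ is always an index attaining the maximum. Lipschitz bound: $K_i$ is an upper bound on the Lipschitz constant of $f_i$ if $|f_i(x_1)-f_i(x_2)|\le K_i\|x_1-x_2\|$ for all $x_1,x_2\in\mathbb{R}^n$. GloRo Net with radius $\delta>0$: for $x\in\mathbb{R}^n$ put $y=f(x)$, $j=F(x)$, and $y_\bot=\max_{i\neq j}\{y_i+(K_i+K_j)\delta\}$. The GloRo Net $\bar f^{\delta}$ has outputs indexed by $[m]\cup\{\bot\}$, with $\bar f^{\delta}_i(x)=y_i$ for $i\in[m]$ and $\bar f^{\delta}_\bot(x)=y_\bot$. Its prediction $\bar F^{\delta}(x)$ is the argmax over $[m]\cup\{\bot\}$ of the outputs of $\bar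 f^{\delta}(x)$, where a tie involving $\bot$ is resolved in favor of $\bot$ (so a class in $[m]$ is predicted only if its output is strictly greater than $\bar f^{\delta}_\bot(x)$). Global robustness: for labels $c_1,c_2\in[m]\cup\{\bot\}$ write $c_1\stackrel{\bot}{=}c_2$ if $c_1=\bot$ or $c_2=\bot$ or $c_1=c_2$. A model $G:\mathbb{R}^n\to[m]\cup\{\bot\}$ is $\epsilon$-globally-robust with respect to $\|\cdot\|$ if for all $x_1,x_2$, $\|x_1-x_2\|\le\epsilon$ implies $G(x_1)\stackrel{\bot}{=}G(x_2)$. *)

(* Defs.v *)
From mathcomp Require Import all_boot all_order all_algebra.
From mathcomp Require Import reals.

Set Implicit Arguments.
Unset Strict Implicit.
Unset Printing Implicit Defensive.

Import Order.TTheory GRing.Theory Num.Theory.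
Local Open Scope ring_scope.

(* R^n is 'rV[R]_n, and the label set [m] is 'I_m.  The library attaches one
   fixed norm to 'rV[R]_n, so an arbitrary norm is a function satisfying the
   axioms of the factory Lmodule_isNormed of mathcomp-analysis. *)
Record is_norm (R : realType) (n : nat) (N : 'rV[R]_n -> R) : Prop := IsNorm {
  norm_triangle : forall x y, N (x + y) <= N x + N y;
  norm_scale : forall (a : R) x, N (a *: x) = `|a| * N x;
  norm_eq0 : forall x, N x = 0 -> x = 0
}.

Definition lipschitz_bound (R : realType) (n : nat) (N : 'rV[R]_n -> R)
    (g : 'rV[R]_n -> R) (k : R) : Prop :=
  forall x1 x2, `|g x1 - g x2| <= k * N (x1 - x2).

(* A relation, because the maximum may be attained at several indices:
   functions satisfying it pointwise are exactly the argmax functions for all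
   ways of breaking ties. *)
Definition is_argmax (R : realType) (I : Type) (y : I -> R) (i : I) : Prop :=
  forall k, y k <= y i.

(* The iterated maximum starts from the value at a witness of P, so it is the
   maximum of y over P whenever P is nonempty; the value 0 for empty P is
   arbitrary. *)
Definition max_over (R : realType) (I : finType) (P : pred I) (y : I -> R) : R :=
  if [pick i | P i] is Some i0 then \big[Num.max/y i0]_(i | P i) y i else 0.

(* The label None stands for \bot. *)
Definition gloro_net (R : realType) (n m : nat)
    (f : 'rV[R]_n -> 'rV[R]_m) (F : 'rV[R]_n -> 'I_m) (K : 'I_m -> R)
    (delta : R) (x : 'rV[R]_n) (c : option 'I_m) : R :=
  let y := f x in
  let j := F x in
  match c with
  | Some i => y 0 i
  | None => max_over (fun i => i != j)
                     (fun i => y 0 i + (K i + K j) * delta)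
  end.

(* Ties between \bot and classes go to \bot; ties between classes are left to
   an arbitrary rule. *)
Definition is_gloro_prediction (R : realType) (m : nat)
    (y : option 'I_m -> R) (c : option 'I_m) : Prop :=
  is_argmax y c /\ (is_argmax y None -> c = None).

Definition bot_eq (m : nat) (c1 c2 : option 'I_m) : Prop :=
  c1 = None \/ c2 = None \/ c1 = c2.

Definition globally_robust (R : realType) (n m : nat) (N : 'rV[R]_n -> R)
    (eps : R) (G : 'rV[R]_n -> option 'I_m) : Prop :=
  forall x1 x2, N (x1 - x2) <= eps -> bot_eq (G x1) (G x2).

(* Main.v *)
Require Import Defs.
From mathcomp Require Import all_boot all_order all_algebra.
From mathcomp Require Import reals.
From mathcomp Require Import lra.

Import Order.TTheory GRing.Theory Num.Theory.
Local Open Scope ring_scope.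

(** If distinct points [x1], [x2] are given distinct classes [a], [b], then the
    constants [K i] are nonnegative, so each predicted class is the argmax of
    [f] and beats the other one by more than [(K a + K b) * (eps / 2)].  Adding
    the two margins contradicts the Lipschitz bounds of [f a] and [f b] over
    the distance [eps]. *)

Lemma max_over_ge (R : realType) (I : finType) (P : pred I) (y : I -> R)
  (i : I) : P i -> y i <= max_over P y.
Proof.
rewrite /max_over; case: pickP => [i0 _|/(_ i) -> //] Pi.
exact: le_bigmax_cond.
Qed.

(** Nonnegativity is not an axiom of [is_norm]; it comes from
    [0 = N (x - x) <= N x + N (- x) = 2 * N x]. *)
Lemma is_norm_gt0 (R : realType) (n : nat) (N : 'rV[R]_n -> R)
  (x : 'rV[R]_n) : is_norm N -> x != 0 -> 0 < N x.
Proof.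
move=> hN /eqP x0.
have N0 : N 0 = 0 by rewrite -(scale0r 0) (norm_scale hN) normr0 mul0r.
have NN : N (- x) = N x by rewrite -scaleN1r (norm_scale hN) normrN1 mul1r.
have Nx0 : N x != 0 by apply/eqP => /(norm_eq0 hN).
have := norm_triangle hN x (- x).
by rewrite subrr N0 NN lt0r Nx0; lra.
Qed.

(** Otherwise [None] would attain the maximum too, and the tie would go to it. *)
Lemma gloro_prediction_margin (R : realType) (m : nat)
  (y : option 'I_m -> R) (i : 'I_m) :
  is_gloro_prediction y (Some i) -> y None < y (Some i).
Proof.
case=> ymax ybot; rewrite ltNge; apply/negP => le_i_bot.
suff /ybot : is_argmax y None by [].
by move=> k; exact: le_trans (ymax k) le_i_bot.
Qed.

Lemma gloro_class_margin (R : realType) (n m : nat)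
  (f : 'rV[R]_n -> 'rV[R]_m) (F : 'rV[R]_n -> 'I_m) (K : 'I_m -> R)
  (delta : R) (x : 'rV[R]_n) (a b : 'I_m) :
  is_argmax (fun i => f x 0 i) (F x) -> (forall i, 0 <= K i) -> 0 <= delta ->
  is_gloro_prediction (gloro_net f F K delta x) (Some a) -> b != a ->
  f x 0 b + (K b + K a) * delta < f x 0 a.
Proof.
move=> Fmax K0 d0 pred_a ba.
have bot_lt := gloro_prediction_margin _ _ _ _ pred_a.
have le_bot i : i != F x ->
    f x 0 i + (K i + K (F x)) * delta <= gloro_net f F K delta x None.
  exact: (max_over_ge _ _ (fun i => i != F x)
    (fun i => f x 0 i + (K i + K (F x)) * delta)).
(* A class other than [F x] has its own output, plus a nonnegative term, among the values maximized
   in the [None] output, so it cannot be predicted. *)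
have aF : a = F x.
  apply/eqP; apply: contraT => /le_bot le_a.
  have := le_lt_trans le_a bot_lt.
  have : 0 <= (K a + K (F x)) * delta by rewrite mulr_ge0 // addr_ge0.
  by rewrite /=; lra.
by rewrite {1}aF; apply: le_lt_trans bot_lt; apply: le_bot; rewrite -aF.
Qed.

Theorem theorem2 (R : realType) (n m : nat) (hm : (2 <= m)%N)
  (f : 'rV[R]_n -> 'rV[R]_m)
  (F : 'rV[R]_n -> 'I_m)
  (hF : forall x, is_argmax (fun i => f x 0 i) (F x))
  (N : 'rV[R]_n -> R) (hN : is_norm N)
  (eps : R) (heps : 0 < eps)
  (K : 'I_m -> R)
  (hK : forall i, lipschitz_bound N (fun x => f x 0 i) (K i))
  (Fbar : 'rV[R]_n -> option 'I_m)
  (hFbar : forall x, is_gloro_prediction (gloro_net f F K (eps / 2) x) (Fbar x)) :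
  globally_robust N eps Fbar.
Proof.
move=> x1 x2 le_eps.
(* The sign of [K i] is read off the Lipschitz bound at two points a positive distance apart. *)
have [->|x12] := eqVneq x1 x2; first by right; right.
have Npos : 0 < N (x1 - x2) by apply: is_norm_gt0; rewrite ?subr_eq0.
have K0 i : 0 <= K i.
  by rewrite -(pmulr_lge0 _ Npos); apply: le_trans (hK i x1 x2).
have d0 : 0 <= eps / 2 by lra.
have := hFbar x2; have := hFbar x1; rewrite /bot_eq.
case: (Fbar x1) => [a|]; last by left.
case: (Fbar x2) => [b|]; last by right; left.
have [->|ab] := eqVneq a b; first by right; right.
rewrite eq_sym in ab.
move=> /(gloro_class_margin _ _ _ _ _ _ _ _ _ _ (hF x1) K0 d0)/(_ ab) lt1.
rewrite eq_sym in ab.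
move=> /(gloro_class_margin _ _ _ _ _ _ _ _ _ _ (hF x2) K0 d0)/(_ ab) lt2.
have lip i : `|f x1 0 i - f x2 0 i| <= K i * eps.
  exact: le_trans (hK i x1 x2) (ler_wpM2l (K0 i) le_eps).
(* From [x2] to [x1], [f b] drops by at most [K b * eps] and [f a] gains at most [K a * eps],
   whereas [lt1] and [lt2] together force more. *)
have := lip a; have := lip b; rewrite !ler_norml => /andP[lb _] /andP[_ ua].
exfalso; lra.
Qed.
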